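(* Let $D\ge 3$. The set of closed $(D+1)$-colored graphs $$S=\bigcup_{\ell\ge 1,\; n\ge 0} S_{\ell,n}$$ is closed under 1-dipole creation and 1-dipole annihilation: any graph obtained from a graph in $S$ by creating or annihilating a 1-dipole (of any species) again belongs to $S$.
   Context: A closed $(D+1)$-colored graph is a finite bipartite multigraph (vertices black or white, every edge joins a black to a white vertex) in which every vertex has exactly $D+1$ incident edges, carrying each of the colors $0,\dots,D$ exactly once. Graphs are considered up to isomorphism preserving edge colors and vertex colors. A $D$-bubble of species $\{\widehat i\}$ is a connected component of the graph obtained by deleting all edges of color $i$. A 1-dipole of species $\{i\}$ consists of a black and a white vertex joined by an edge of color $i$ and lying in two distinct $D$-bubbles of species $\{\widehat i\}$. Annihilating it means deleting the two vertices and the edge of color $i$ joining them and, for each color $j\neq i$, joining the two resulting half-edges of color $j$ into one edge. Creation of a 1-dipole of species $\{i\}$ is the inverse operation: choose $D$ edges, one of each color $j\ne i$, cut each of them, attach the $D$ half-edges hanging from white vertices to a new black vertex and the $D$ half-edges hanging from black vertices to a new white vertex, and join the two new vertices by an edge of color $i$; this is a 1-dipole creation provided the two new vertices lie in distinct $D$-bubbles of species $\{\widehat i\}$ of the resulting graph. Insertion of an elementary melon on an edge of color $i$ joining a black vertex $b$ to a white vertex $w$: delete the edge, add a new black vertex $b'$ and a new white vertex $w'$ joined to each other by $D$ edges, one of each color different from $i$, and add edges of color $i$ joining $b$ to $w'$ and $b'$ to $w$. For distinct colors $i_0,i_1$ and $\ell\geq1$, the graph $\mathcal G_{2\text{-dipole},\ell}$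 of species $\{i_0,i_1\}$ has $2\ell$ black vertices $v_1,\dots,v_{2\ell}$ and $2\ell$ white vertices $\bar v_1,\dots,\bar v_{2\ell}$ (indices modulo $2\ell$), with edges: for every color $j\notin\{i_0,i_1\}$ and every $k$, an edge of color $j$ joining $v_k$ and $\bar v_k$; for every odd $k$, edges of color $i_0$ joining $v_k$ to $\bar v_{k+1}$ and $v_{k+1}$ to $\bar v_k$; for every even $k$, edges of color $i_1$ joining $v_k$ to $\bar v_{k+1}$ and $v_{k+1}$ to $\bar v_k$. $S_{\ell,n}$ is the set of closed graphs obtained from a graph $\mathcal G_{2\text{-dipole},\ell}$ (of any species $\{i_0,i_1\}$) by successively inserting $n$ elementary melons on arbitrary edges. *)

(* Defs.v *)
From mathcomp Require Import all_boot.

Set Implicit Arguments.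
Unset Strict Implicit.
Unset Printing Implicit Defensive.

(* Every vertex carries exactly one edge of each color, so the edges of color i
   form a perfect matching between black and white vertices: [mate i b] is the
   white end of the edge of color i at b, and that edge is designated by the
   pair (i, b).  Parallel edges of different colors are allowed. *)
Record cgraph (D : nat) := CGraph {
  black : finType;
  white : finType;
  mate : 'I_D.+1 -> black -> white;
  mate_bij : forall i, bijective (mate i)
}.

Section ColoredGraphs.

Variable D : nat.
Implicit Types (G H : cgraph D) (i j : 'I_D.+1).

Definition iso G H : Prop :=
  exists (f : black G -> black H) (g : white G -> white H),
    [/\ bijective f, bijective g & forall i b, mate i (f b) = g (mate i b)].

Definition vertex G : finType := (black G + white G)%type.

(* Adjacency in the graph where all edges of color i have been deleted. *)
Definition adj_hat G i : rel (vertex G) := fun u v =>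
  match u, v with
  | inl b, inr w | inr w, inl b => [exists j, (j != i) && (mate j b == w)]
  | _, _ => false
  end.

(* Vertex set of the D-bubble of species {\hat i} containing v. *)
Definition bubble G i (v : vertex G) : {set vertex G} :=
  [set u | connect (@adj_hat G i) v u].

Definition dipole1 G i (b : black G) (w : white G) : Prop :=
  mate i b = w /\ bubble i (inl b) <> bubble i (inr w).

Lemma mate_inj G i : injective (@mate D G i).
Proof. exact: bij_inj (mate_bij G i). Qed.

Lemma card_black_white G : #|white G| = #|black G|.
Proof. by apply/esym; exact: bij_eq_card (mate_bij G ord0). Qed.

Section Annihilation.

Variables (G : cgraph D) (b : black G) (w : white G).

(* For a color j, the black half-edge towards w and the white half-edge from b
   are glued; when b and w are joined by color j, that edge just disappears. *)
Definition annih_fun j (x : black G) : white G :=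
  if mate j x == w then mate j b else mate j x.

Lemma annih_subproof j (x : {x : black G | x != b}) : annih_fun j (val x) != w.
Proof.
rewrite /annih_fun; case: ifPn => // /eqP e.
by rewrite -e (inj_eq (@mate_inj G j)) eq_sym (valP x).
Qed.

Definition annih_mate j (x : {x : black G | x != b}) : {y : white G | y != w} :=
  Sub (annih_fun j (val x)) (annih_subproof j x).

Lemma annih_mate_bij j : bijective (annih_mate j).
Proof.
apply: inj_card_bij => [x y /(congr1 val) /=|]; last first.
  rewrite !card_sig (eq_card (B := predC1 w)) //.
  rewrite [leqRHS](eq_card (B := predC1 b)) //.
  by rewrite !cardC1 card_black_white.
case: x y => [x hx] [y hy] exy; apply: val_inj => /=.
move: exy; rewrite /= /annih_fun.
case: eqP => [ex|_]; case: eqP => [ey|_].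
- by move=> _; apply: (@mate_inj G j); rewrite ex ey.
- by move/mate_inj => e; rewrite e eqxx in hy.
- by move/mate_inj => e; rewrite e eqxx in hx.
- by move/mate_inj.
Qed.

Definition annihilate : cgraph D := CGraph annih_mate_bij.

End Annihilation.

Section Creation.

Variables (G : cgraph D) (i : 'I_D.+1) (c : 'I_D.+1 -> black G).

(* The edge of color j <> i that is cut is the one at the black vertex [c j];
   the value [c i] is irrelevant.  [None] is the new vertex of either color. *)
Definition create_mate j (x : option (black G)) : option (white G) :=
  if j == i then omap (mate i) x
  else if x is Some b then if b == c j then None else Some (mate j b)
  else Some (mate j (c j)).

Lemma create_mate_bij j : bijective (create_mate j).
Proof.
apply: inj_card_bij; last by rewrite !card_option card_black_white.
rewrite /create_mate; case: eqP => _ [x|] [y|] //=.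
- by case=> /mate_inj ->.
- case: eqP => [->|_]; case: eqP => [->|_] //.
  by case=> /mate_inj ->.
- by case: eqP => // ne [] /mate_inj.
- by case: eqP => // ne [] /mate_inj /esym.
Qed.

Definition create : cgraph D := CGraph create_mate_bij.

End Creation.

Section Melon.

Variables (G : cgraph D) (i : 'I_D.+1) (b : black G).

Definition melon_mate j (x : option (black G)) : option (white G) :=
  if j == i then
    if x is Some b' then if b' == b then None else Some (mate i b')
    else Some (mate i b)
  else omap (mate j) x.

Lemma melon_mate_bij j : bijective (melon_mate j).
Proof.
apply: inj_card_bij; last by rewrite !card_option card_black_white.
rewrite /melon_mate; case: eqP => _ [x|] [y|] //=.
- case: eqP => [->|_]; case: eqP => [->|_] //.
  by case=> /mate_inj ->.
- by case: eqP => // ne [] /mate_inj.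
- by case: eqP => // ne [] /mate_inj /esym.
- by case=> /mate_inj ->.
Qed.

Definition insert_melon : cgraph D := CGraph melon_mate_bij.

End Melon.

(* Result of annihilating, resp. creating, a 1-dipole of species {i}; graphs
   are considered up to isomorphism. *)
Definition annihilation1 i G G' : Prop :=
  exists (b : black G) (w : white G), dipole1 i b w /\ iso (annihilate b w) G'.

Definition creation1 i G G' : Prop :=
  exists c : 'I_D.+1 -> black G,
    @dipole1 (create i c) i None None /\ iso (create i c) G'.

Section TwoDipole.

Variables (i0 i1 : 'I_D.+1) (l : nat).

(* v_k and \bar v_k are both represented by the residue of k modulo 2l, i.e. by
   an element of 'I_(l.*2); parity is well defined on residues.  [ordS] and
   [ord_pred] are the cyclic successor and predecessor. *)
Definition two_dipole_mate (j : 'I_D.+1) (k : 'I_(l.*2)) : 'I_(l.*2) :=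
  if j == i0 then if odd k then ordS k else ord_pred k
  else if j == i1 then if odd k then ord_pred k else ordS k
  else k.

Lemma odd_ordS (k : 'I_(l.*2)) : odd (ordS k) = ~~ odd k.
Proof. by rewrite /= odd_mod ?odd_double. Qed.

Lemma odd_ord_pred (k : 'I_(l.*2)) : odd (ord_pred k) = ~~ odd k.
Proof. by rewrite -{2}(ord_predK k) odd_ordS negbK. Qed.

Lemma two_dipole_mateK j : involutive (two_dipole_mate j).
Proof.
rewrite /two_dipole_mate => k; case: eqP => _; last case: eqP => _ //.
- by case: (boolP (odd k)) => ok;
    rewrite ?odd_ordS ?odd_ord_pred ok /= ?ordSK ?ord_predK.
- by case: (boolP (odd k)) => ok;
    rewrite ?odd_ordS ?odd_ord_pred ok /= ?ordSK ?ord_predK.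
Qed.

Definition two_dipole : cgraph D :=
  CGraph (fun j => inv_bij (two_dipole_mateK j)).

End TwoDipole.

(* [S_ln l n G]: G belongs to S_{l,n}. *)
Inductive S_ln (l : nat) : nat -> cgraph D -> Prop :=
| S_two_dipole i0 i1 G : i0 != i1 -> iso (two_dipole i0 i1 l) G -> S_ln l 0 G
| S_insert_melon n G i (b : black G) G' :
    S_ln l n G -> iso (insert_melon i b) G' -> S_ln l n.+1 G'.

Definition S_set G : Prop := exists l n, 0 < l /\ S_ln l n G.

End ColoredGraphs.

(* Main.v *)
(* Melon insertion and 1-dipole creation are both the insertion of a new pair of
   vertices on a prescribed set of edges of distinct colors, and two successive
   insertions can always be interchanged. So one inducts on the number of
   melons, moving the outermost melon past the dipole move.

   That the new pair is a 1-dipole of species {i} means that the black ends of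
   the cut edges are separated from their white ends by a cut of the graph
   without color i, crossed by no other edge. If the cut separates the two
   vertices of the outermost melon, then all the cut edges are incident to one
   vertex, in which case the creation is a melon insertion, or exactly one of
   them, of color c, avoids the melon. The latter configuration [rung_pair] is
   handled by a second induction, which reduces it to rings, where it inserts
   two more rungs between two consecutive ones. On a ring, a 1-dipole creation
   is always a melon insertion, and annihilating a 1-dipole removes two
   consecutive rungs and inserts a melon. *)

Require Import Defs.
From mathcomp Require Import all_boot.
From mathcomp Require Import zify.

Set Implicit Arguments.
Unset Strict Implicit.
Unset Printing Implicit Defensive.

(** * Isomorphisms of colored graphs *)

Section Isomorphism.

Variable D : nat.
Implicit Types (G H K : cgraph D) (i j : 'I_D.+1).

Definition iso_by G H (f : black G -> black H) (g : white G -> white H) : Prop :=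
  [/\ bijective f, bijective g & forall i b, mate i (f b) = g (mate i b)].

Lemma iso_by_iso G H (f : black G -> black H) (g : white G -> white H) :
  iso_by f g -> iso G H.
Proof. by exists f, g. Qed.

Lemma iso_by_inv G H (f : black G -> black H) (g : white G -> white H) :
  iso_by f g ->
  exists f' g', [/\ cancel f f', cancel f' f, cancel g g', cancel g' g &
                   @iso_by H G f' g'].
Proof.
case=> -[f' fK f'K] [g' gK g'K] fg; exists f', g'; split=> //; split.
- by exists f.
- by exists g.
by move=> i b; apply: (can_inj gK); rewrite -fg f'K g'K.
Qed.

Lemma iso_by_comp G H K (f : black G -> black H) (g : white G -> white H)
    (f' : black H -> black K) (g' : white H -> white K) :
  iso_by f g -> iso_by f' g' -> iso_by (f' \o f) (g' \o g).
Proof.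
case=> f1 g1 e1 [f2 g2 e2]; split; [exact: bij_comp|exact: bij_comp|].
by move=> i b /=; rewrite e2 e1.
Qed.

Lemma iso_refl G : iso G G.
Proof. by exists id, id; split=> //; exists id. Qed.

Lemma iso_sym G H : iso G H -> iso H G.
Proof. by case=> f [g /iso_by_inv [f' [g' [_ _ _ _]]]]; apply: iso_by_iso. Qed.

Lemma iso_trans G H K : iso G H -> iso H K -> iso G K.
Proof.
case=> f [g fg] [f' [g' fg']]; exact: iso_by_iso (iso_by_comp fg fg').
Qed.

End Isomorphism.

(** * Insertion of two vertices *)

Section Insertion.

Variable D : nat.
Implicit Types (G H K : cgraph D) (i j : 'I_D.+1).

(* Melon insertion and 1-dipole creation both add a black and a white vertex,
   both called [None]. For each color j, [s j = Some b] says that the edge of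
   color j at b is cut and reattached to the new vertices, while [s j = None]
   says that an edge of color j joins the new vertices. *)
Definition ins_mate G (s : 'I_D.+1 -> option (black G)) j
    (x : option (black G)) : option (white G) :=
  if x is Some b then if s j == Some b then None else Some (mate j b)
  else omap (mate j) (s j).

Lemma ins_mate_bij G s j : bijective (@ins_mate G s j).
Proof.
apply: inj_card_bij; last by rewrite !card_option card_black_white.
move=> [x|] [y|] //=; case: (s j) => [z|] //=.
- rewrite !(inj_eq Some_inj).
  case: (z =P x) => [<-|_]; case: (z =P y) => [<-|_] //.
  by case=> /mate_inj ->.
- by case=> /mate_inj ->.
- by rewrite (inj_eq Some_inj); case: eqP => // ne [] /mate_inj /esym.
- by rewrite (inj_eq Some_inj); case: eqP => // ne [] /mate_inj.
Qed.

Definition ins G s : cgraph D := CGraph (@ins_mate_bij G s).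

(** The pattern that makes [ins] a melon insertion. As [option T] is also the vertex type after an
    insertion, [mel] later doubles as a choice of cut edges: at [b] for color [i], at the vertex
    inserted before for all others. *)
Definition mel (T : Type) i (b : T) j : option T := if j == i then Some b else None.

Definition cre (T : Type) i (c : 'I_D.+1 -> T) j : option T :=
  if j == i then None else Some (c j).

Lemma ins_iso G H (f : black G -> black H) (g : white G -> white H) s s' :
  iso_by f g -> (forall j, s' j = omap f (s j)) ->
  @iso_by D (ins s) (ins s') (omap f) (omap g).
Proof.
move=> fgP es; have [f' [g' [fK f'K gK g'K _]]] := iso_by_inv fgP.
split.
- by exists (omap f'); case=> //= x; rewrite ?fK ?f'K.
- by exists (omap g'); case=> //= x; rewrite ?gK ?g'K.
case: fgP => _ _ fg i [b|] /=; rewrite es; case: (s i) => [x|] //=.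
- rewrite !(inj_eq Some_inj) (can_eq fK); case: eqP => //= _.
  by rewrite fg.
- by rewrite fg.
- by rewrite fg.
Qed.

Lemma ins_ext G (s s' : 'I_D.+1 -> option (black G)) :
  s =1 s' -> iso (ins s) (ins s').
Proof.
move=> es; apply: (@iso_by_iso D (ins s) (ins s') (omap id) (omap id)).
apply: ins_iso => [|j]; first by split=> //; exists id.
by rewrite es; case: (s' j).
Qed.

Lemma iso_insert_melon G i b : iso (insert_melon i b) (ins (@mel (black G) i b)).
Proof.
exists id, id; split; [by exists id|by exists id|] => j [x|] /=.
- rewrite /mel /melon_mate; case: (j =P i) => [->|_] //=.
  by rewrite (inj_eq Some_inj) eq_sym.
- by rewrite /mel /melon_mate; case: (j =P i) => [->|_].
Qed.

Lemma iso_create G i c : iso (@create D G i c) (ins (cre i c)).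
Proof.
exists id, id; split; [by exists id|by exists id|] => j [x|] /=.
- rewrite /cre /create_mate; case: (j =P i) => [->|_] //=.
  by rewrite (inj_eq Some_inj) eq_sym.
- by rewrite /cre /create_mate; case: (j =P i) => [->|_].
Qed.

(** * Interchange of two insertions *)

Definition oswap (T : Type) (x : option (option T)) : option (option T) :=
  match x with
  | None => Some None
  | Some None => None
  | Some (Some a) => Some (Some a)
  end.

Lemma oswapK (T : Type) : involutive (@oswap T).
Proof. by case=> [[]|]. Qed.

(** What the outer pattern [s] becomes once the inner pair is removed: a cut at the inner black
    vertex moves to the edge [t j] that carried the inner pair, or, if [t j] is [None], leaves the
    outer pair joined by color [j]. *)
Definition swap_in (T : Type) (s : 'I_D.+1 -> option (option T))
    (t : 'I_D.+1 -> option T) j : option T :=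
  match s j with None => None | Some None => t j | Some (Some x) => Some x end.

(** The pattern that puts the inner pair back last. When both pairs cut the edge at [x], the outer
    one comes first along it, so the inner one goes on the edge at the outer black vertex. *)
Definition swap_out (T : eqType) (s : 'I_D.+1 -> option (option T))
    (t : 'I_D.+1 -> option T) j : option (option T) :=
  match s j with
  | None => omap Some (t j)
  | Some None => Some (t j)
  | Some (Some x) => if t j == Some x then Some None else omap Some (t j)
  end.

Lemma ins_swap G (t : 'I_D.+1 -> option (black G)) s s' t' :
  s' =1 swap_in s t -> t' =1 swap_out s t ->
  @iso_by D (@ins (@ins G t) s) (@ins (@ins G s') t') (@oswap _) (@oswap _).
Proof.
move=> es' et'; split; try exact: inv_bij (@oswapK _).
move=> j [[x|]|] /=; rewrite /ins_mate es' et' /swap_in /swap_out;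
  case: (s j) => [[y|]|] //=; case: (t j) => [z|] //=;
  rewrite ?eqxx ?(inj_eq Some_inj) //=.
all: do ?[case: (@eqP (black G)) => [?|?] //=;
          rewrite ?eqxx ?(inj_eq Some_inj) //=]; try congruence.
Qed.

Definition swapN (T : eqType) (b : T) (x : option T) : option T :=
  if x is Some y then if y == b then None else Some y else Some b.

Lemma swapNK (T : eqType) (b : T) : involutive (swapN b).
Proof. by case=> [y|] /=; rewrite ?eqxx //; case: eqP => [->|/eqP/negPf /= ->]. Qed.

(** The new black vertex takes over all edges of [b] except that of color [i], hence the role of
    [b]; [b] and the new white vertex become the melon. *)
Lemma ins_cre_black G i (b : black G) :
  @iso_by D (ins (@cre (black G) i (fun=> b))) (ins (@mel (black G) i b)) (swapN b) id.
Proof.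
split; [exact: inv_bij (swapNK b)|by exists id|].
move=> j [x|] /=; rewrite /cre /mel; case: (j =P i) => [->|/eqP/negPf nji] /=;
  rewrite ?nji ?eqxx ?(inj_eq Some_inj) //=.
all: do ?[case: (@eqP (black G)) => [?|?] //=;
          rewrite ?nji ?eqxx ?(inj_eq Some_inj) //=]; congruence.
Qed.

(** The mirror image. The value [c i], free in [cre], must here designate the edge of color [i] at
    [w], which receives the melon. *)
Lemma ins_cre_white G i (c : 'I_D.+1 -> black G) w (hc : forall j, mate j (c j) = w) :
  @iso_by D (ins (cre i c)) (ins (@mel (black G) i (c i))) id (swapN w).
Proof.
split; [by exists id|exact: inv_bij (swapNK w)|].
move=> j [x|] /=; rewrite /cre /mel; case: (j =P i) => [->|/eqP/negPf nji] /=;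
  rewrite ?nji ?(inj_eq Some_inj) ?hc ?eqxx //=.
- by rewrite -(hc i) (inj_eq (@mate_inj _ _ _)) eq_sym; case: eqP => // ->.
- rewrite eq_sym; case: (x =P c j) => [->|ne]; rewrite ?hc //=.
  by rewrite -(hc j) (inj_eq (@mate_inj _ _ _)); case: eqP ne.
Qed.

End Insertion.

(** * Annihilation as the inverse of insertion *)

Section AnnihilationInsertion.

Variable D : nat.
Implicit Types (G H K : cgraph D) (i j : 'I_D.+1).

Lemma annihilate_iso G H (f : black G -> black H) (g : white G -> white H) b w :
  iso_by f g -> iso (annihilate b w) (annihilate (f b) (g w)).
Proof.
move=> fgP; have [f' [g' [fK f'K gK g'K _]]] := iso_by_inv fgP.
case: fgP => _ _ fg.
have hf (x : {x : black G | x != b}) : f (val x) != f b.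
  by rewrite (can_eq fK) (valP x).
have hg (y : {y : white G | y != w}) : g (val y) != g w.
  by rewrite (can_eq gK) (valP y).
have hf' (x : {x : black H | x != f b}) : f' (val x) != b.
  by rewrite (can2_eq f'K fK) (valP x).
have hg' (y : {y : white H | y != g w}) : g' (val y) != w.
  by rewrite (can2_eq g'K gK) (valP y).
exists (fun x => exist _ (f (val x)) (hf x)), (fun y => exist _ (g (val y)) (hg y)); split.
- by exists (fun x => exist _ (f' (val x)) (hf' x)) => x; apply: val_inj; rewrite /= ?fK ?f'K.
- by exists (fun y => exist _ (g' (val y)) (hg' y)) => x; apply: val_inj; rewrite /= ?gK ?g'K.
move=> j x; apply: val_inj; rewrite /= /annih_fun !fg (can_eq gK).
by case: ifP.
Qed.

Lemma annihilate_ins G (s : 'I_D.+1 -> option (black G)) :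
  iso (@annihilate D (ins s) None None) G.
Proof.
apply: iso_sym.
exists (fun x : black G => Sub (Some x) isT : {x : option (black G) | x != None}),
       (fun x : white G => Sub (Some x) isT : {x : option (white G) | x != None}).
split.
- apply: inj_card_bij => [x y /(congr1 val) [] //|].
  by rewrite card_sig (eq_card (B := predC1 None)) // cardC1 card_option.
- apply: inj_card_bij => [x y /(congr1 val) [] //|].
  by rewrite card_sig (eq_card (B := predC1 None)) // cardC1 card_option.
move=> j x; apply: val_inj; rewrite /= /annih_fun /=.
by case: (s j =P Some x) => [->|].
Qed.

(** The pattern that undoes an annihilation, found from the black ends of the edges at [w]. [insub]
    yields [None] exactly when that end is [b], that is, when color [j] joins [b] to [w]. *)
Definition reinsert G (b : black G) (w : white G) j : option {x : black G | x != b} :=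
  obind insub [pick y | mate j y == w].

Definition unsub (T : eqType) (b : T) (x : option {x : T | x != b}) : T :=
  if x is Some y then val y else b.

Lemma unsub_bij (T : eqType) (b : T) : bijective (@unsub T b).
Proof.
exists insub => [[x|]|x] /=.
- by rewrite valK.
- by rewrite insubF ?eqxx.
- by case: insubP => [u _ //|] /=; rewrite negbK => /eqP.
Qed.

Lemma ins_annihilate G (b : black G) (w : white G) :
  @iso_by D (@ins D (annihilate b w) (reinsert b w)) G (@unsub _ b) (@unsub _ w).
Proof.
split; [exact: unsub_bij|exact: unsub_bij|].
move=> j x.
have [z zw] : exists z, mate j z = w.
  by case: (mate_bij G j) => m' _ m'K; exists (m' w).
subst w; have rj : reinsert b (mate j z) j = insub z.
  rewrite /reinsert; case: pickP => [y /eqP|/(_ z)]; last by rewrite eqxx.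
  by move/mate_inj ->.
case: x => [[x hx]|] /=; rewrite rj; case: insubP => [u _ uz|] /=.
- rewrite (inj_eq Some_inj) -val_eqE uz /=; case: (z =P x) => [->|/eqP ne] //=.
  by rewrite /annih_fun (inj_eq (@mate_inj _ _ _)) eq_sym (negPf ne).
- rewrite negbK => /eqP zb /=; rewrite /annih_fun (inj_eq (@mate_inj _ _ _)).
  by rewrite zb (negPf hx).
- by rewrite /annih_fun uz eqxx.
- by rewrite negbK => /eqP ->.
Qed.

End AnnihilationInsertion.

(** * Bubbles and cuts *)

Section Cut.

Variable D : nat.
Implicit Types (G H K : cgraph D) (i j : 'I_D.+1).

(** The sides are the black and white vertices of the component of [w] after deletion of color [i].
    Later arguments use only this cut. *)
Lemma dipole_cut G i b w : dipole1 i b w ->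
  exists (XB : pred (black G)) (XW : pred (white G)),
    [/\ ~~ XB b, XW w & forall j x, j != i -> XW (mate j x) = XB x].
Proof.
case=> _ ne.
have sym : connect_sym (@adj_hat D G i).
  by apply: sym_connect_sym => [[x|x] [y|y]].
exists (fun x => connect (@adj_hat D G i) (inr w) (inl x)).
exists (fun x => connect (@adj_hat D G i) (inr w) (inr x)).
split; rewrite ?connect0 //.
- apply/negP => con; apply: ne; apply/setP => u; rewrite !inE.
  by rewrite (same_connect sym con).
- move=> j x ne_ji; apply/esym; apply: (same_connect1r sym) => /=.
  by apply/existsP; exists j; rewrite ne_ji eqxx.
Qed.
End Cut.

(** Reindexing by [s] preserves the number of points of [h], so a discrepancy at [e] alone is
    impossible. On a ring: a side cannot change exactly once. *)
Lemma bij_const_off (T : finType) (s : T -> T) (h : pred T) (e : T) :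
  bijective s -> (forall x, x != e -> h (s x) = h x) -> h (s e) = h e.
Proof.
move=> sb hs; have: \sum_x (h (s x) : nat) = \sum_x (h x : nat).
  by rewrite [RHS](reindex s) //; exact: onW_bij.
rewrite (bigD1 e) // [RHS](bigD1 e) //=.
rewrite (eq_bigr (fun x => h x : nat)) => [/addIn|x /hs -> //].
by case: (h (s e)); case: (h e).
Qed.

(** * Two-dipole rings *)

Section Ring.

Variable D : nat.
Implicit Types (i j c : 'I_D.+1) (l : nat).

Lemma val_ordS n (k : 'I_n) : ordS k = (if k.+1 == n then 0 else k.+1) :> nat.
Proof.
have := ltn_ord k; rewrite /= leq_eqVlt.
by case: eqP => [->|_ /= lt]; rewrite ?modnn ?modn_small.
Qed.

Lemma val_ord_pred n (k : 'I_n) :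
  ord_pred k = (if k == 0 :> nat then n.-1 else k.-1) :> nat.
Proof.
have := ltn_ord k; case: n k => [[]//|n] [[|k] lek] /= lt.
  by rewrite modn_small.
by rewrite modnDr modn_small // ltnW.
Qed.

Lemma rev_ordS n (k : 'I_n) : rev_ord (ordS k) = ord_pred (rev_ord k).
Proof.
apply: val_inj; transitivity (n - (ordS k).+1) => //.
apply/esym; transitivity (ord_pred (rev_ord k) : nat) => //.
rewrite val_ord_pred val_ordS /=; have := ltn_ord k.
by do 2 case: eqP; lia.
Qed.

Lemma rev_ord_pred n (k : 'I_n) : rev_ord (ord_pred k) = ordS (rev_ord k).
Proof. by rewrite -[k in RHS]ord_predK rev_ordS ord_predK. Qed.

Lemma odd_rev_ord l (k : 'I_(l.*2)) : odd (rev_ord k) = ~~ odd k.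
Proof. by have := ltn_ord k; rewrite /=; lia. Qed.

Lemma two_dipole_mate_rev i0 i1 l j (k : 'I_(l.*2)) :
  two_dipole_mate i0 i1 j (rev_ord k) = rev_ord (two_dipole_mate i0 i1 j k).
Proof.
rewrite /two_dipole_mate odd_rev_ord.
by do 2?[case: eqP => _]; case: (odd k); rewrite /= ?rev_ordS ?rev_ord_pred.
Qed.

Lemma two_dipole_mate_ordS i0 i1 l j (k : 'I_(l.*2)) : i0 != i1 ->
  two_dipole_mate i1 i0 j (ordS k) = ordS (two_dipole_mate i0 i1 j k).
Proof.
move=> ne; rewrite /two_dipole_mate odd_ordS.
case: (j =P i0) => [->|_]; rewrite ?(negPf ne); last case: eqP => // _.
all: by case: (odd k); rewrite /= ?ordSK ?ord_predK.
Qed.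

Lemma two_dipole_mate_iter i0 i1 l j m (k : 'I_(l.*2)) : i0 != i1 ->
  two_dipole_mate (if odd m then i1 else i0) (if odd m then i0 else i1) j
    (iter m (@ordS _) k) = iter m (@ordS _) (two_dipole_mate i0 i1 j k).
Proof.
move=> ne; elim: m => //= m <-; case: (odd m) => /=; apply: two_dipole_mate_ordS => //.
by rewrite eq_sym.
Qed.

Lemma iter_ordS_reach n (k t : 'I_n) : exists m, iter m (@ordS _) k = t.
Proof.
exists (n - k + t); apply: val_inj.
have -> m : val (iter m (@ordS _) k) = (k + m) %% n.
  elim: m => [|m IHm]; first by rewrite addn0 modn_small.
  by rewrite iterS /= IHm -addn1 modnDml addn1 addnS.
by rewrite addnA subnKC ?modnDl ?modn_small // ltnW.
Qed.

Lemma odd_iter_ordS l m (k : 'I_(l.*2)) : odd (iter m (@ordS _) k) = odd m (+) odd k.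
Proof. by elim: m => // m IHm; rewrite iterS odd_ordS IHm -addNb. Qed.

(** Rotation by one step exchanges the rail colors, while reversal keeps them and changes parity. So
    [k] is reversed if its parity does not suit the order of [c] and [i], then rotated to [t]. *)
Lemma two_dipole_normalize i0 i1 c i l (k t : 'I_(l.*2)) :
  i0 != i1 -> (c, i) \in [:: (i0, i1); (i1, i0)] -> odd t ->
  exists2 f : 'I_(l.*2) -> 'I_(l.*2),
    @iso_by D (two_dipole i0 i1 l) (two_dipole c i l) f f & f k = t.
Proof.
move=> ne; rewrite !inE => ci ot.
suff [k' [r [rb rk rm odd_k]]] : exists k' : 'I_(l.*2), exists r : 'I_(l.*2) -> 'I_(l.*2),
    [/\ bijective r, r k = k',
        forall j x, two_dipole_mate i0 i1 j (r x) = r (two_dipole_mate i0 i1 j x) &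
        odd k' = ((c, i) == (i0, i1))].
  have [m mk] := iter_ordS_reach k' t.
  exists (iter m (@ordS _) \o r); last by rewrite /= rk.
  have bm : bijective (iter m (@ordS (l.*2))).
    by elim: m {mk} => [|m IHm] /=; [exists id|apply: (bij_comp (@ordS_bij _) IHm)].
  split; [exact: bij_comp|exact: bij_comp|] => j x /=.
  rewrite -rm -(two_dipole_mate_iter _ _ _ ne).
  have := odd_iter_ordS m k'; rewrite mk ot odd_k; move: ci.
  case: eqP => [[-> ->] _|_ /= /eqP [-> ->]]; case: (odd m) => //.
have rr : bijective (@rev_ord (l.*2)) by exact: inv_bij rev_ordK.
have [e|ne'] := boolP (odd k == ((c, i) == (i0, i1))).
  by exists k, id; split=> //; [exists id|apply/eqP].
exists (rev_ord k), (@rev_ord _); split=> //; [exact: two_dipole_mate_rev|].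

by rewrite odd_rev_ord; move: ne'; case: ((c, i) == _); case: (odd k).
Qed.

(* The last two rungs of the longer ring join the black vertex of the 1-dipole to
   the white vertex of the melon, and conversely. *)
Definition ring_pos_black (n : nat) (x : option (option 'I_n)) : nat :=
  match x with Some (Some k) => k | Some None => n.+1 | None => n end.

Definition ring_pos_white (n : nat) (x : option (option 'I_n)) : nat :=
  match x with Some (Some k) => k | Some None => n | None => n.+1 end.

Lemma val_two_dipole_mate i0 i1 l j (k : 'I_(l.*2)) :
  two_dipole_mate i0 i1 j k =
   (if j == i0 then if odd k then if k.+1 == l.*2 then 0 else k.+1
                    else if k == 0 :> nat then l.*2.-1 else k.-1
    else if j == i1 then if odd k then if k == 0 :> nat then l.*2.-1 else k.-1
                    else if k.+1 == l.*2 then 0 else k.+1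
    else k) :> nat.
Proof.
rewrite /two_dipole_mate.
by case: (j == i0); [|case: (j == i1)]; case: (odd k);
  rewrite ?val_ordS ?val_ord_pred.
Qed.

(** The melon lies on an [i0] edge between the last rung and the first; the creation cuts the
    parallel edge and the melon's inner edges except that of color [i1]. The ring thus opens there
    to receive two rungs. *)
Lemma two_dipole_extend i0 i1 l (e g : 'I_(l.*2)) : i0 != i1 ->
  e = l.*2.-1 :> nat -> g = 0 :> nat ->
  exists f h, [/\ @iso_by D
      (@ins D (@ins D (two_dipole i0 i1 l) (mel i0 e)) (cre i1 (mel i0 g)))
      (two_dipole i0 i1 l.+1) f h,
    f None = l.*2 :> nat & h None = l.*2.+1 :> nat].
Proof.
move=> ne ve vg.
set n := l.*2.
pose f (x : option (option 'I_n)) : 'I_(l.+1.*2) := inord (ring_pos_black x).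
pose h (x : option (option 'I_n)) : 'I_(l.+1.*2) := inord (ring_pos_white x).
have vf x : f x = ring_pos_black x :> nat.
  by rewrite inordK //; case: x => [[x|]|] //=; rewrite ltnW // ltnW // ltnS ltnS ltn_ord.
have vh x : h x = ring_pos_white x :> nat.
  by rewrite inordK //; case: x => [[x|]|] //=; rewrite ltnW // ltnW // ltnS ltnS ltn_ord.
exists f, h; split; rewrite ?vf ?vh //; split.
- apply: inj_card_bij; last by rewrite !card_option !card_ord.
  move=> x y /(congr1 val); rewrite /= !vf.
  case: x y => [[x|]|] [[y|]|] //=; try have := ltn_ord x; try have := ltn_ord y;
    rewrite -/n; try lia.
  by move=> _ _ /val_inj ->.
- apply: inj_card_bij; last by rewrite !card_option !card_ord.
  move=> x y /(congr1 val); rewrite /= !vh.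
  case: x y => [[x|]|] [[y|]|] //=; try have := ltn_ord x; try have := ltn_ord y;
    rewrite -/n; try lia.
  by move=> _ _ /val_inj ->.
move=> j x; apply: val_inj; rewrite /= vh val_two_dipole_mate vf.
have := ltn_ord g.
case: (j =P i0) => [->|/eqP/negPf j0]; [|case: (j =P i1) => [->|/eqP/negPf j1]];
  case: x => [[x|]|] /=; try (have := ltn_ord x);
  rewrite /ins_mate /cre /mel ?eqxx ?(eq_sym i1) ?(negPf ne) ?j0 ?j1 //=;
  rewrite ?(inj_eq Some_inj) -?val_eqE /= ?vg ?ve.
all: do ?[case: (_ =P _ :> nat) => /= ?];
  rewrite ?val_two_dipole_mate ?eqxx ?(eq_sym i1) ?(negPf ne) ?j0 ?j1 ?ve ?vg //=.
all: subst n; do ?[case: ifP => /=]; try lia.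
Qed.

End Ring.

(** * Closure under 1-dipole moves *)

Section Closure.

Variable D : nat.
Hypothesis hD : 3 <= D.
Implicit Types (G H K : cgraph D) (i j c : 'I_D.+1) (l : nat).

(** [3 <= D] provides at least four colors. *)
Lemma other_color i j c : exists x, [/\ x != i, x != j & x != c].
Proof.
have : [set i; j; c] != setT.
  apply/negP => /eqP /(congr1 (fun A : {set _} => #|A|)).
  rewrite cardsT card_ord => e.
  have := leq_card_setU [set i; j] [set c]; rewrite e cards1 cards2.
  by case=> + _; case: (i != j) => /=; lia.
rewrite -subTset => /subsetPn [x _]; rewrite !inE !negb_or -andbA.
by case/and3P; exists x.
Qed.

Lemma S_set_iso G H : S_set G -> iso G H -> S_set H.
Proof.
case=> l [n [l0 SG]] GH; exists l, n; split=> //.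
case: SG GH => [i0 i1 K ne KG|m K i b K' SK KG] GH.
- exact: S_two_dipole ne (iso_trans KG GH).
- exact: S_insert_melon SK (iso_trans KG GH).
Qed.

Lemma S_set_two_dipole i0 i1 l : i0 != i1 -> 0 < l -> S_set (two_dipole i0 i1 l).
Proof. by move=> ne l0; exists l, 0; split=> //; exact: S_two_dipole ne (iso_refl _). Qed.

Lemma S_set_mel G i (b : black G) : S_set G -> S_set (ins (@mel D (black G) i b)).
Proof.
case=> l [n [l0 SG]]; exists l, n.+1; split=> //.
exact: S_insert_melon SG (iso_insert_melon _ _).
Qed.

Lemma S_set_ind (P : cgraph D -> Prop) :
  (forall G H, P G -> iso G H -> P H) ->
  (forall i0 i1 l, i0 != i1 -> 0 < l -> P (two_dipole i0 i1 l)) ->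
  (forall G i (b : black G), S_set G -> P G -> P (ins (@mel D (black G) i b))) ->
  forall G, S_set G -> P G.
Proof.
move=> Piso Pring Pmel G [l [n [l0]]].
elim=> {n G} [i0 i1 G ne|n G i b G' SG PG]; first by apply: Piso; exact: Pring.
move=> GG'; apply: (Piso _ _ _ GG').
apply: (Piso _ _ (Pmel _ i b _ PG)); first by exists l, n.
exact/iso_sym/iso_insert_melon.
Qed.

Lemma S_set_cre_black G i (b : black G) (c : 'I_D.+1 -> black G) :
  S_set G -> (forall j, j != i -> c j = b) -> S_set (ins (cre i c)).
Proof.
move=> SG cb; apply: S_set_iso (S_set_mel i b SG) _.
apply: iso_trans (iso_sym (iso_by_iso (ins_cre_black i b))) _.
by apply: ins_ext => j; rewrite /cre; case: eqP => // /eqP /cb ->.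
Qed.

Lemma S_set_cre_white G i (w : white G) (c : 'I_D.+1 -> black G) :
  S_set G -> (forall j, j != i -> mate j (c j) = w) -> S_set (ins (cre i c)).
Proof.
move=> SG cw; have [m' _ m'K] := mate_bij G i.
(* [c i] is arbitrary, whereas [ins_cre_white] wants the edge of color [i] at [w]. *)
pose c' j := if j == i then m' w else c j.
have cw' j : mate j (c' j) = w.
  by rewrite /c'; case: eqP => [->|/eqP /cw].
apply: S_set_iso (S_set_mel i (c' i) SG) _.
apply: iso_trans (iso_sym (iso_by_iso (ins_cre_white i cw'))) _.
by apply: ins_ext => j; rewrite /cre /c'; case: eqP.
Qed.

(** Since [s] cuts no edge joining the two melon vertices, the melon remains a melon when it is
    moved outermost. *)
Lemma S_set_swap G i (b : black G) s s' :
  (forall j, j != i -> s j <> Some None) ->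
  s' =1 swap_in s (mel i b) -> S_set (ins s') ->
  S_set (@ins D (ins (@mel D (black G) i b)) s).
Proof.
move=> hs es' Ss'.
have [b' eb'] : exists b', swap_out s (mel i b) =1 @mel D (option (black G)) i b'.
  case eb : (swap_out s (mel i b) i) => [b'|]; last first.
    move: eb; rewrite /swap_out /mel eqxx; case: (s i) => [[x|]|] //=.
    by case: ifP.
  exists b' => j; rewrite {2}/mel; case: eqP => [->//|/eqP ne].
  move: (hs _ ne); rewrite /swap_out /mel (negPf ne).
  by case: (s j) => [[x|]|].
apply: S_set_iso (@S_set_mel (ins s') i b' Ss') (iso_sym _).
exact: iso_by_iso (ins_swap es' (fsym eb')).
Qed.

(* The subgraph obtained by inserting a melon on the edge (c, e) and then
   cutting the edge (c, g) of the result together with all edges of the melon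
   except that of color i. In the two-dipole ring of species {c, i}, when
   (c, e) and (c, g) are the two parallel edges of color c between consecutive
   rungs, it lengthens the ring by two rungs. *)
Definition rung_pair G i c (e g : black G) : cgraph D :=
  @ins D (@ins D G (mel c e)) (cre i (mel c g)).

Lemma rung_pair_iso G H (f : black G -> black H) (h : white G -> white H) i c e g :
  iso_by f h -> iso (rung_pair i c e g) (rung_pair i c (f e) (f g)).
Proof.
move=> fh; apply: iso_by_iso; apply: ins_iso.
  by apply: ins_iso fh _ => j; rewrite /mel; case: eqP.
by move=> j; rewrite /cre /mel; case: eqP => // _; case: eqP.
Qed.

(** All cut edges end at the white vertex of the melon. *)
Lemma S_set_rung_pair_same G i c (e : black G) : S_set G -> S_set (rung_pair i c e e).
Proof.
move=> SG; apply: (@S_set_cre_white (ins (mel c e)) i None) => [|j _]; first exact: S_set_mel.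
rewrite /= /ins_mate /mel; by case: (j =P c) => [->|/eqP/negPf jc]; rewrite ?eqxx.
Qed.

Lemma two_dipole_mateE i0 i1 l c (k : 'I_(l.*2)) : i0 != i1 -> c \in [:: i0; i1] ->
  two_dipole_mate i0 i1 c k =
  if odd k == (c == i0) then ordS k else ord_pred k.
Proof.
rewrite !inE /two_dipole_mate => ne /orP [] /eqP ->; rewrite eqxx.
  by case: (odd k).
by rewrite eq_sym (negPf ne); case: (odd k).
Qed.

Lemma two_dipole_rung i0 i1 l j (k : 'I_(l.*2)) : j != i0 -> j != i1 ->
  two_dipole_mate i0 i1 j k = k.
Proof. by rewrite /two_dipole_mate => /negPf -> /negPf ->. Qed.

Lemma ordS_neq l (k : 'I_(l.*2)) : ordS k != k.
Proof. by apply/eqP => e; have := odd_ordS k; rewrite e; case: (odd k). Qed.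

Lemma ord_pred_neq l (k : 'I_(l.*2)) : ord_pred k != k.
Proof. by apply/eqP => e; have := odd_ord_pred k; rewrite e; case: (odd k). Qed.

Lemma S_set_two_dipole_adjacent_rails i0 i1 l c i (e : 'I_(l.*2)) : i0 != i1 ->
  (c, i) \in [:: (i0, i1); (i1, i0)] ->
  S_set (@rung_pair (two_dipole i0 i1 l) i c e (two_dipole_mate i0 i1 c e)).
Proof.
move=> ne ci; have l0 : 0 < l.*2 by apply: leq_ltn_trans (ltn_ord e).
have lt : l.*2.-1 < l.*2 by rewrite ltn_predL.
have ot : odd (Ordinal lt) by rewrite /=; lia.
have [f fP fe] := two_dipole_normalize e ne ci ot.
have nci : c != i by move: ci; rewrite !inE => /orP [] /eqP [-> ->]; rewrite // eq_sym.
have [F [h [Fh _ _]]] : exists F h, [/\ @iso_by D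
   (@rung_pair (two_dipole c i l) i c (f e) (f (two_dipole_mate i0 i1 c e)))
   (two_dipole c i l.+1) F h, F None = l.*2 :> nat & h None = l.*2.+1 :> nat].
  apply: two_dipole_extend => //; first by rewrite fe.
  case: fP => _ _ /(_ c e) /= <-.
  by rewrite val_two_dipole_mate eqxx fe ot /= prednK // eqxx.
apply: S_set_iso (S_set_two_dipole nci (ltn0Sn l)) (iso_sym _).
apply: iso_trans (iso_by_iso Fh).
exact: (@rung_pair_iso (two_dipole i0 i1 l) (two_dipole c i l) f f i c e _ fP).
Qed.

(* The edges (c, e) and (c, g) are the only edges of color other than i that
   cross the cut, the former entering it and the latter leaving it, when edges
   are oriented from their black to their white end. *)
Definition pair_cut G i c (e g : black G) (XB : pred (black G)) (XW : pred (white G)) :=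
  [/\ ~~ XB e, XB g & forall j x, j != i ->
      XW (mate j x) = if j == c then (x == e) || (XB x && (x != g)) else XB x].

Lemma two_dipole_mateK' i0 i1 l c : involutive (@two_dipole_mate D i0 i1 l c).
Proof. exact: two_dipole_mateK. Qed.

(** A rung color other than [i] puts both ends of each rung on one side. The crossing edges are then
    parallel, and [i] is the other rail color, since otherwise the side would change exactly once
    around the ring. *)
Lemma two_dipole_pair_rails i0 i1 l c i (e g : 'I_(l.*2)) XB XW : i0 != i1 ->
  c \in [:: i0; i1] -> c != i ->
  @pair_cut (two_dipole i0 i1 l) i c e g XB XW ->
  (c, i) \in [:: (i0, i1); (i1, i0)] /\ g = two_dipole_mate i0 i1 c e.
Proof.
move=> ne hc nci [eX gX cutX].
have [r [r0 r1 ri]] := other_color i0 i1 i.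
have rc : r != c by move: hc; rewrite !inE => /orP [] /eqP ->.
have WB x : XW x = XB x.
  by have := cutX r x ri; rewrite /= two_dipole_rung // (negPf rc).
set s := two_dipole_mate i0 i1 c.
have sX x : XB (s x) = (x == e) || (XB x && (x != g)).
  by have := cutX c x nci; rewrite /= WB eqxx.
have sK : involutive s by exact: two_dipole_mateK.
have se : s e = g.
  have := sX (s e); rewrite sK (negPf eX) sX eqxx /=.
  by case: (s e =P g) => // _; rewrite orbT.
split; last by rewrite se.
have [d [hd ndc dsub]] : exists d, [/\ d \in [:: i0; i1], d != c &
    (c, d) \in [:: (i0, i1); (i1, i0)]].
  move: hc; rewrite !inE => /orP [] /eqP ->.
  - by exists i1; rewrite eq_sym ne !inE !eqxx !orbT.
  - by exists i0; rewrite ne !inE !eqxx !orbT.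
case: (i =P d) => [->//|/eqP nid].
have dX x : XB (two_dipole_mate i0 i1 d x) = XB x.
  by have := cutX d x; rewrite eq_sym nid (negPf ndc) /= WB => ->.
pose q := c == i0.
have sE x : s x = if odd x == q then ordS x else ord_pred x.
  exact: two_dipole_mateE.
have dE (x : 'I_(l.*2)) : two_dipole_mate i0 i1 d x = if odd x == q then ord_pred x else ordS x.
  rewrite two_dipole_mateE // /q; have -> : (d == i0) = ~~ (c == i0).
    move: dsub; rewrite !inE => /orP [] /eqP [-> ->]; rewrite eqxx.
      by rewrite eq_sym (negPf ne).
    by rewrite eq_sym ne.
  by case: (odd x); case: (c == i0).
have odds x : odd (s x) = ~~ odd x.
  by rewrite sE; case: ifP; rewrite ?odd_ordS ?odd_ord_pred.
(* [p] is whichever of [e] and [g] has its edge of color [c] leading to the successor. *)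
have [p [op ph]] : exists p : 'I_(l.*2), odd p == q /\ (p = e /\ s p = g \/ p = g /\ s p = e).
  have [oe|oe] := boolP (odd e == q); first by exists e; rewrite oe; split=> //; left.
  exists g; split; last by right; rewrite -se sK.
  by rewrite -se odds; move: oe; case: (odd e); case: (q).
have := @bij_const_off _ (@ordS (l.*2)) XB p (@ordS_bij _).
have -> : ordS p = s p by rewrite sE op.
suff hx x : x != p -> XB (ordS x) = XB x.
  by move/(_ hx); case: ph => [[-> ->]|[-> ->]]; rewrite gX (negPf eX).
move=> xp; case: (boolP (odd x == q)) => ox; last first.
  by have := dX x; rewrite dE (negPf ox).
have := sX x; rewrite sE ox => ->.
have xsp : x != s p.
  by apply/eqP => exs; move: ox op; rewrite exs odds; case: (odd p); case: (q).
by case: ph xsp xp => [[-> ->]|[-> ->]] /negPf -> /negPf ->; rewrite andbT.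
Qed.

(** If [c] is a rung color, the cut forces exactly four colors and [l = 1]; that graph on four
    vertices looks the same with rails and rungs exchanged. *)
Lemma S_set_two_dipole_rung_pair i0 i1 l c i (e g : 'I_(l.*2)) XB XW : i0 != i1 -> 0 < l ->
  c != i -> @pair_cut (two_dipole i0 i1 l) i c e g XB XW ->
  S_set (@rung_pair (two_dipole i0 i1 l) i c e g).
Proof.
move=> ne l0 nci cutX.
have [hc|] := boolP (c \in [:: i0; i1]).
  have [ci ->] := two_dipole_pair_rails ne hc nci cutX.
  exact: S_set_two_dipole_adjacent_rails.
rewrite !inE negb_or => /andP [c0 c1]; case: cutX => eX gX cutX.
have only_i j : j != i0 -> j != i1 -> j != c -> j = i.
  move=> j0 j1 jc; apply/eqP; apply: contraNT eX => ji.
  have := cutX c e nci; rewrite /= two_dipole_rung // !eqxx /= => We.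
  by have := cutX j e ji; rewrite /= two_dipole_rung // We (negPf jc) => <-.
have [r [r0 r1 rc]] := other_color i0 i1 c.
have ri := only_i r r0 r1 rc; rewrite {r}ri in r0 r1 rc.
have W x : XW x = (x == e) || (XB x && (x != g)).
  by have := cutX c x nci; rewrite /= two_dipole_rung // eqxx.
have rail s : s \in [:: i0; i1] -> two_dipole_mate i0 i1 s e = g.
  move=> hs; have [nsi nsc] : s != i /\ s != c.
    by move: hs; rewrite !inE => /orP [] /eqP ->; rewrite ![_ == i]eq_sym ![_ == c]eq_sym.
  have := cutX s (two_dipole_mate i0 i1 s e) nsi.
  rewrite /= (negPf nsc) two_dipole_mateK' W eqxx /= => Xs.
  have := cutX s e nsi; rewrite /= (negPf nsc) W -Xs (negPf eX) /= => /negbT.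
  by rewrite negb_or negbK => /andP [_ /eqP].
have e01 : ordS e = ord_pred e.
  have := rail i0; have := rail i1; rewrite !two_dipole_mateE ?inE ?eqxx ?orbT //.
  rewrite [i1 == i0]eq_sym (negPf ne) => /(_ isT) + /(_ isT).
  by case: (odd e) => /= -> ->.
have l1 : l = 1.
  move: (congr1 (@nat_of_ord _) e01); have := ltn_ord e.
  by rewrite val_ordS val_ord_pred; do 2 case: eqP; lia.
subst l.
have flip (k : 'I_(1.*2)) : ord_pred k = ordS k.
  by case: k => [[|[|k]]] //= lt; apply: val_inj.
(* Shifting the white vertices by one turns [c] and [i] into the rail colors. *)
have R : @iso_by D (two_dipole i0 i1 1) (two_dipole c i 1) id (@ordS _).
  split=> [||j k]; [by exists id|exact: ordS_bij|].
  rewrite /= /two_dipole_mate !flip !if_same.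
  case: (j =P c) => [->|/eqP jc]; first by rewrite (negPf c0) (negPf c1).
  case: (j =P i0) => [->|/eqP j0].
    by rewrite eq_sym (negPf r0) -flip ordSK.
  case: (j =P i1) => [->|/eqP j1].
    by rewrite eq_sym (negPf r1) -flip ordSK.
  by rewrite (only_i j j0 j1 jc) eqxx.
have iR := @rung_pair_iso (two_dipole i0 i1 1) (two_dipole c i 1) _ _ i c e g R.
apply: (S_set_iso _ (iso_sym iR)).
have -> : g = two_dipole_mate c i c e.
  rewrite -(rail i0) ?inE ?eqxx // two_dipole_mateE ?inE ?eqxx //.
  by rewrite flip if_same /two_dipole_mate eqxx flip if_same.
by apply: S_set_two_dipole_adjacent_rails; rewrite ?inE ?eqxx.
Qed.

Lemma S_set_rung_pair G : S_set G -> forall i c (e g : black G) XB XW,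
  c != i -> pair_cut i c e g XB XW -> S_set (rung_pair i c e g).
Proof.
move: G; apply: S_set_ind => [G H IH [f [h fh]]|i0 i1 l ne l0|K c1 e0 SK IH] i c e g XB XW nci.
- have [f' [h' [fK f'K _ _ fh']]] := iso_by_inv fh.
  move=> [eX gX cutX]; apply: S_set_iso (iso_sym (rung_pair_iso i c e g fh')).
  apply: (IH i c _ _ (XB \o f) (XW \o h) nci); split; rewrite /= ?f'K //.
  move=> j x ji; case: fh => _ _ <-; rewrite cutX // -{1}(f'K e) -{1}(f'K g).
  by rewrite !(can_eq fK).
- exact: S_set_two_dipole_rung_pair.
move=> [eX gX cutX].
have [r [ri rc r1]] := other_color i c c1.
have XN : XW None = XB None.
  by have := cutX r None ri; rewrite /= /mel (negPf r1) (negPf rc).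
(* For [c != c1], color [c] joins the two melon vertices, which lie on the same side. *)
have cN : c != c1 -> e != None /\ g != None.
  move=> cc1; have := cutX c None nci.
  rewrite /= /mel (negPf cc1) eqxx XN; move: eX gX.
  by case: e {cutX} => [x|]; case: g => [y|] //= eX gX; rewrite ?andbF ?(negPf eX) // gX.
(* [e2] is [e] seen in [K], [e1] is where the melon of color [c1] goes when inserted after that of
   color [c], and [d] lists the edges the creation then cuts. *)
pose e2 := odflt e0 e.
pose e1 := if (c == c1) && (e == Some e0) then None else Some e0.
pose d j := if j == c then if g is Some y then Some y else e1 else None.
have red : S_set (@ins D (@ins D K (mel c e2)) (cre i d)) -> S_set (rung_pair i c e g).
  move=> Sd.
  pose A := @ins D (@ins D K (mel c1 e0)) (mel c e).
  pose B := @ins D (@ins D K (mel c e2)) (mel c1 e1).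
  have sw : @iso_by D A B (@oswap _) (@oswap _).
    apply: ins_swap => j; rewrite /swap_in /swap_out /mel.
      case: (j =P c) => // ->; rewrite /e2; case: e cN {cutX eX A B e2 e1 d Sd} => //=.
      by case: (c =P c1) => // _ /(_ isT) [].
    rewrite /e1; case: (j =P c) => [->|/eqP jc].
      case: (c =P c1) => [<-|/eqP cc1] /=.
        rewrite ?eqxx; case: (e) => [x|] //=.
        by rewrite !(inj_eq Some_inj) eq_sym; case: eqP.
      by case: e cN {cutX eX A B e2 e1 d Sd} => //= /(_ cc1) [].
    case: (j =P c1) jc => [->|//]; rewrite eq_sym => /negPf -> /=.
    by [].
  have sw2 := iso_by_iso (@ins_iso D A B _ _ (cre i (mel c g)) _ sw (fun j => erefl)).
  apply: S_set_iso (iso_sym sw2).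
  apply: (@S_set_swap (@ins D K (mel c e2)) c1 e1 _ (cre i d)) => //.
  - move=> j jc1; rewrite /cre /mel; case: (j == i) => //=.
    case: (j =P c) => // jc; have cc1 : c != c1 by rewrite -jc.
    by have [_] := cN cc1; case: (g).
  - move=> j; rewrite /swap_in /cre /mel /d; case: (j == i) => //=.
    case: (j =P c) => [->|] //=; case: g cN {cutX gX d Sd sw2} => //=.
    by case: (c =P c1) => // _ /(_ isT) [].
have K_off j x : j != i -> j != c -> XW (Some (mate j x)) = XB (Some x).
  move=> ji jc; have := cutX j (Some x) ji; have := cutX j None ji.
  rewrite /= /mel (negPf jc); case: (j =P c1) => //= _.
  by rewrite (inj_eq Some_inj); case: (e0 =P x) => [->|_ _] // -> <-; rewrite XN.
have K_c x : (c != c1) || (x != e0) ->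
    XW (Some (mate c x)) = (Some x == e) || (XB (Some x) && (Some x != g)).
  have := cutX c (Some x) nci; rewrite /= /mel eqxx.
  by case: (c == c1) => //=; rewrite (inj_eq Some_inj) eq_sym; case: (x == e0).
have K_e0 : c == c1 ->
    XB None = (Some e0 == e) || (XB (Some e0) && (Some e0 != g)) /\
    XW (Some (mate c e0)) = (None == e) || (XB None && (None != g)).
  move=> cc1; have := cutX c (Some e0) nci; have := cutX c None nci.
  by rewrite /= /mel cc1 /= !eqxx XN => -> ->.
apply: red.
have fin g2 : d c = Some g2 ->
    e2 = g2 \/ pair_cut i c e2 g2 (XB \o Some) (XW \o Some) ->
    S_set (@ins D (@ins D K (mel c e2)) (cre i d)).
  move=> dc alt; have : S_set (rung_pair i c e2 g2).
    by case: alt => [->|]; [exact: S_set_rung_pair_same|exact: IH nci].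
  move/S_set_iso; apply; apply: (@ins_ext D (@ins D K (mel c e2))) => j.
  rewrite /cre; congr (if _ then _ else Some _); rewrite /mel -dc.
  by case: (j =P c) => [->|/eqP/negPf jc]; rewrite // /d jc.
case: e g @e2 @e1 @d fin eX gX cutX cN K_e0 K_c
  => [x0|] [y0|] e2 e1 d fin eX gX cutX cN K_e0 K_c.
- apply: (fin y0); first by rewrite /d eqxx.
  right; split=> // j x ji /=; have [->|jc] := eqVneq j c; last exact: K_off.
  have [|e0x] := boolP ((c != c1) || (x != e0)); first exact: K_c.
  move: e0x; rewrite negb_or !negbK => /andP [cc1 /eqP ->].
  by have [+ ->] := K_e0 cc1; rewrite /= andbT.
- have cc1 : c == c1 by apply: contraT => /cN [].
  have [XN1 XN2] := K_e0 cc1.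
  have [x0e|x0e] := eqVneq x0 e0.
    (* Both melons lie on one edge and the cut falls between them, so every cut edge is at the black
       vertex of the melon of color [c]. *)
    apply: (@S_set_cre_black (@ins D K (mel c e2)) i None) => [|j ji]; first exact: S_set_mel.
    by rewrite /d /e1 cc1 x0e eqxx if_same.
  apply: (fin e0); first by rewrite /d /e1 eqxx (inj_eq Some_inj) (negPf x0e) andbF.
  move: XN1; rewrite gX (inj_eq Some_inj) eq_sym (negPf x0e) andbT /= => XT.
  right; split=> // j x ji /=; have [->|jc] := eqVneq j c; last exact: K_off.
  have [->|xe] := eqVneq x e0.
    by rewrite XN2 !andbF /= eq_sym (negPf x0e).
  by rewrite K_c ?xe ?orbT // andbT.
- have cc1 : c == c1 by apply: contraT => /cN [].
  have [XN1 XN2] := K_e0 cc1.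
  apply: (fin y0); first by rewrite /d eqxx.
  have [ye|ye] := eqVneq y0 e0; [by left|right].
  move: XN1; rewrite (negPf eX) (inj_eq Some_inj) [e0 == _]eq_sym ye andbT /= => XF.
  split=> //=; first by rewrite -XF.
  move=> j x ji /=; have [->|jc] := eqVneq j c; last exact: K_off.
  have [->|xe] := eqVneq x e0; first by rewrite XN2.
  by rewrite K_c ?xe ?orbT.
- by rewrite gX in eX.
Qed.

(** * 1-dipole creation *)

Definition creation_cut G i (c : 'I_D.+1 -> black G)
    (XB : pred (black G)) (XW : pred (white G)) :=
  forall j, j != i -> XB (c j) /\ forall x, XW (mate j x) = XB x && (x != c j).

(** The new white vertex is inside the cut and the new black one outside; hence, in [G], every cut
    edge leaves the inside. *)
Lemma create_cut G i (c : 'I_D.+1 -> black G) :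
  @dipole1 D (create i c) i None None -> exists XB XW, creation_cut i c XB XW.
Proof.
move=> /dipole_cut [XB [XW [XB0 XW0 cutX]]].
exists (XB \o Some), (XW \o Some) => j ji /=.
have Xc : XB (Some (c j)) by rewrite -(cutX j _ ji) /= /create_mate (negPf ji) eqxx.
split=> // x; have [->|xc] := eqVneq x (c j).
  by rewrite andbF -[RHS](negPf XB0) -(cutX j None ji) /= /create_mate (negPf ji).
by rewrite andbT -(cutX j _ ji) /= /create_mate (negPf ji) (negPf xc).
Qed.

(** All cut edges share the black or the white end of one rung [k], so the creation is a melon
    insertion. *)
Lemma S_set_two_dipole_create i0 i1 l i (c : 'I_D.+1 -> 'I_(l.*2)) XB XW : i0 != i1 -> 0 < l ->
  @creation_cut (two_dipole i0 i1 l) i c XB XW ->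
  S_set (@ins D (two_dipole i0 i1 l) (cre i c)).
Proof.
move=> ne l0 cutX; have SR := S_set_two_dipole ne l0.
have [r [r0 r1 ri]] := other_color i0 i1 i.
pose k := c r; have [Xk WB] := cutX r ri.
have {}WB x : XW x = XB x && (x != k) by have := WB x; rewrite /= two_dipole_rung.
have rung j : j != i -> j != i0 -> j != i1 -> c j = k.
  move=> ji j0 j1; have [Xj /(_ (c j))] := cutX j ji.
  rewrite /= two_dipole_rung // WB Xj eqxx /= => /negbT.
  by rewrite negbK => /eqP.
pose s j := @two_dipole_mate D i0 i1 l j.
have sK j : involutive (s j) by exact: two_dipole_mateK.
have cut j x : j != i -> XB (s j x) && (s j x != k) = XB x && (x != c j).
  by move=> ji; have [_ /(_ x)] := cutX j ji; rewrite /= WB.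
have Xc j : j != i -> XB (c j) by move=> /cutX [].
have near j : j != i -> c j != k -> s j (c j) = k.
  move=> ji cjk; apply/eqP; apply: contraNT cjk => sck.
  have := cut j (c j) ji; rewrite eqxx andbF sck andbT => XF.
  have := cut j (s j (c j)) ji; rewrite sK XF /= Xc //= => /negbT.
  by rewrite negbK.
have rail j : j \in [:: i0; i1] -> j != i -> (c j == k) = ~~ XB (s j k).
  move=> hj ji; have := cut j k ji; rewrite Xk /=.
  have -> : s j k != k.
    by rewrite /s two_dipole_mateE //; case: ifP => _; rewrite ?ordS_neq ?ord_pred_neq.
  by rewrite andbT => ->; rewrite negbK eq_sym.
have h0 : i0 \in [:: i0; i1] by rewrite !inE eqxx.
have h1 : i1 \in [:: i0; i1] by rewrite !inE eqxx orbT.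
have XX : i0 != i -> i1 != i -> XB (s i0 k) = XB (s i1 k).
  (* [h] is [XB] with its value at [k] replaced by that at the successor. It could change only on
     the step into [k], which counting excludes; so both neighbors of [k] lie on one side. *)
  move=> n0 n1; pose h x := if x == k then XB (ordS k) else XB x.
  have := @bij_const_off _ (@ordS (l.*2)) h (ord_pred k) (@ordS_bij _).
  rewrite ord_predK /h eqxx (negPf (ord_pred_neq k)).
  suff hx x : x != ord_pred k -> h (ordS x) = h x.
    move/(_ hx); rewrite /s !two_dipole_mateE // eqxx [i1 == i0]eq_sym (negPf ne).
    by case: (odd k).
  rewrite -(can_eq (@ordSK _)) ord_predK /h => /negPf xk; rewrite xk.
  case: eqP => [->//|/eqP nxk].
  have [j [hj ji sj]] : exists j, [/\ j \in [:: i0; i1], j != i & s j x = ordS x].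
    case ox : (odd x).
      by exists i0; rewrite /s two_dipole_mateE // ox eqxx.
    by exists i1; rewrite /s two_dipole_mateE // ox [i1 == i0]eq_sym (negPf ne).
  have := cut j x ji; rewrite sj xk andbT => ->.
  have [xc|_] := eqVneq x (c j); last by rewrite andbT.
  by move: (near j ji); rewrite -xc nxk sj => /(_ isT) /eqP; rewrite xk.
have all_rail j j' : j \in [:: i0; i1] -> j != i -> j' \in [:: i0; i1] -> j' != i ->
    (c j == k) = (c j' == k).
  move=> hj ji hj' j'i; rewrite !rail //; congr (~~ _).
  move: hj ji hj' j'i; rewrite !inE.
  do 2![case/orP => /eqP -> ?] => //; first exact: XX.
  exact/esym/XX.
have [q [hq qi]] : exists q, q \in [:: i0; i1] /\ q != i.
  have [e|] := eqVneq i0 i; last by exists i0.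
  by exists i1; rewrite -e eq_sym.
case: (boolP (c q == k)) => cq.
- apply: (@S_set_cre_black (two_dipole i0 i1 l) i k) => // j ji.
  case: (boolP (j \in [:: i0; i1])) => hj.
    by apply/eqP; rewrite (all_rail j q).
  by move: hj; rewrite !inE negb_or => /andP [j0 j1]; exact: rung.
- apply: (@S_set_cre_white (two_dipole i0 i1 l) i k) => // j ji.
  case: (boolP (j \in [:: i0; i1])) => hj.
    by apply: near => //; rewrite (all_rail j q).
  move: hj; rewrite !inE negb_or => /andP [j0 j1].
  by rewrite /= two_dipole_rung // rung.
Qed.

Lemma S_set_create G : S_set G -> forall i (c : 'I_D.+1 -> black G) XB XW,
  creation_cut i c XB XW -> S_set (ins (cre i c)).
Proof.
move: G; apply: S_set_ind => [G H IH [f [h fh]]|i0 i1 l ne l0|H m e SH IH] i c XB XW cutX.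
- have [f' [h' [fK f'K _ _ fh']]] := iso_by_inv fh.
  have iG := ins_iso (s := cre i c) fh' (fun j => erefl).
  apply: S_set_iso (iso_sym (iso_by_iso iG)).
  have : S_set (ins (cre i (f' \o c))).
    apply: (IH i _ (XB \o f) (XW \o h)) => j ji /=; rewrite f'K.
    have [Xc cX] := cutX j ji; split=> // x; case: fh => _ _ <-.
    by rewrite cX (can2_eq fK f'K).
  by move/S_set_iso; apply; apply: ins_ext => j; rewrite /cre; case: eqP.
- exact: S_set_two_dipole_create cutX.
have [r [ri rm _]] := other_color i m m.
have XN j : j != i -> j != m -> XW None = XB None && (None != c j).
  by move=> ji jm; have [_ /(_ None)] := cutX j ji; rewrite /= /mel (negPf jm).
have [same|] := boolP (XW None == XB None).
- have cN j : j != i -> j != m -> c j != None.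
    move=> ji jm; have [Xc _] := cutX j ji.
    apply/eqP => E; move: (XN j ji jm) same; rewrite E eqxx andbF => ->.
    by rewrite -E Xc.
  (* No edge inside the melon is cut; a cut at its black vertex becomes a cut at [e] in [H]. *)
  pose c' j := odflt e (c j).
  apply: (@S_set_swap H m e _ (cre i c')).
  + move=> j jm; rewrite /cre; case: (eqVneq j i) => // ji [] E.
    by have := cN j ji jm; rewrite E.
  + move=> j; rewrite /swap_in /cre /c'; case: (eqVneq j i) => //= ji.
    case E : (c j) => [x|] //=; rewrite /mel; case: (eqVneq j m) => // jm.
    by have := cN j ji jm; rewrite E.
  apply: (IH i c' (XB \o Some) (XW \o Some)) => j ji /=.
  have [Xc cX] := cutX j ji; have := cX None; have := cX (Some e).
  have cSx x : j != m \/ x != e -> XW (Some (mate j x)) = XB (Some x) && (Some x != c j).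
    rewrite -cX /= /mel; case: (eqVneq j m) => [_ [//|xe]|] //=.
    by rewrite (inj_eq Some_inj) eq_sym (negPf xe).
  rewrite /= /mel /c'; case: (eqVneq j m) => [jm|jm] /=.
  + rewrite eqxx; case E : (c j) Xc cSx => [y|] Xc cSx /= Xe XM.
      split=> // x; have [->|xe] := eqVneq x e; last by apply: cSx; right.
      by rewrite XM andbT -(eqP same).
    move: Xe; rewrite (eqP same) Xc andbT => <-; split=> // x.
    have [->|xe] := eqVneq x e; first by rewrite XM !andbF.
    by apply: cSx; right.
  + move=> _ _; case E : (c j) Xc cSx (cN j ji jm) => [y|] //= Xc cSx _.
    by split=> // x; apply: cSx; left.
(* The cut separates the melon vertices, so every color other than [i] and [m] is cut inside the
   melon; only the cut of color [m] remains to be located. *)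
- move=> diff.
  have XNB : XB None by move: diff; rewrite (XN r) //; case: (XB None).
  have cN j : j != i -> j != m -> c j = None.
    move=> ji jm; move: diff; rewrite (XN j) // XNB /=.
    by case: (c j).
  have SG := S_set_mel m e SH.
  have XNW : XW None = false by rewrite (XN r) // cN // andbF.
  have black_case : (forall j, j != i -> c j = None) -> S_set (ins (cre i c)).
    exact: (S_set_cre_black SG).
  have [im|im] := eqVneq m i.
    by apply: black_case => j ji; apply: cN; rewrite // im.
  case E : (c m) => [g|]; last first.
    by apply: black_case => j ji; have [->//|] := eqVneq j m; exact: cN.
  have [Xg cX] := cutX m im; rewrite E in Xg.
  have [ge|ge] := eqVneq g e.
    apply: (@S_set_cre_white (ins (mel m e)) i None) => // j ji.
    rewrite /= /mel; have [->|jm] := eqVneq j m; first by rewrite E ge /= !eqxx.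
    by rewrite cN //= (negPf jm).
  suff : S_set (rung_pair i m e g).
    move/S_set_iso; apply; apply: (@ins_ext D (ins (mel m e))) => j.
    rewrite /cre /mel; case: (eqVneq j i) => // ji.
    by have [->|jm] := eqVneq j m; rewrite ?E ?cN.
  apply: (@S_set_rung_pair H SH i m e g (XB \o Some) (XW \o Some)) => //.
  have := cX (Some e); have := cX None.
  rewrite /= /mel !eqxx /= XNW XNB E (inj_eq Some_inj) [e == g]eq_sym ge andbT /= => XM Xe.
  split=> //=; first by rewrite -Xe.
  move=> j x ji; have [->|jm] := eqVneq j m; last first.
    have [_ /(_ (Some x))] := cutX j ji.
    by rewrite /= /mel (negPf jm) /= cN // andbT.
  have [->|xe] := eqVneq x e; first by rewrite XM.
  have := cX (Some x); rewrite /= /mel eqxx (inj_eq Some_inj) [e == x]eq_sym (negPf xe) E.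
  by rewrite (inj_eq Some_inj).
Qed.

(** * 1-dipole annihilation *)

Definition annihilation_cut G i (b : black G)
    (XB : pred (black G)) (XW : pred (white G)) :=
  [/\ ~~ XB b, XW (mate i b) & forall j x, j != i -> XW (mate j x) = XB x].

(** Rungs do not cross the cut, so the dipole edge is a rail. The ring is then a shorter ring with a
    melon, on which this dipole was created. *)
Lemma S_set_two_dipole_annihilate i0 i1 l i (b : 'I_(l.*2)) XB XW : i0 != i1 ->
  @annihilation_cut (two_dipole i0 i1 l) i b XB XW ->
  S_set (@annihilate D (two_dipole i0 i1 l) b (two_dipole_mate i0 i1 i b)).
Proof.
move=> ne [bX wX cutX].
have [r [r0 r1 ri]] := other_color i0 i1 i.
have WB x : XW x = XB x by have := cutX r x ri; rewrite /= two_dipole_rung.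
have hi : i \in [:: i0; i1].
  apply: contraNT bX; rewrite !inE negb_or => /andP [n0 n1].
  by move: wX; rewrite /= two_dipole_rung // WB.
have [d [hd nid di]] : exists d, [/\ d \in [:: i0; i1], d != i &
    (d, i) \in [:: (i0, i1); (i1, i0)]].
  move: hi; rewrite !inE => /orP [] /eqP ->.
  - by exists i1; rewrite eq_sym ne !inE !eqxx ?orbT.
  - by exists i0; rewrite ne !inE !eqxx ?orbT.
(* Of the two rails at [b] only one crosses the cut, but for [l = 1] they have the same white
   end. *)
have ib_db : two_dipole_mate i0 i1 i b != two_dipole_mate i0 i1 d b.
  apply: contraNneq bX => E; rewrite -(cutX d b nid) /= -E.
  exact: wX.
have l2 : 1 < l.
  apply: contraNT ib_db => l1; have o0 : ord_pred b = ordS b.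
    have l1' : l = 1 by have := ltn_ord b; lia.
    subst l; apply: val_inj.
    by case: b {bX wX cutX l1 WB} XB => [[|[|k]]].
  by rewrite !two_dipole_mateE // o0 !if_same.
case: l l2 b XB XW bX wX cutX WB ib_db => // l l0 b XB XW _ _ _ _ _.
set w := two_dipole_mate i0 i1 i b.
have lt : l.+1.*2.-1 < l.+1.*2 by [].
have ot : odd (Ordinal lt) by rewrite /=; lia.
have [f fP fw] := two_dipole_normalize w ne di ot.
have lt1 : l.*2.-1 < l.*2 by rewrite ltn_predL; lia.
have lt0 : 0 < l.*2 by lia.
have [F [h [Fh F0 h0]]] :=
  @two_dipole_extend D d i l (Ordinal lt1) (Ordinal lt0) nid erefl erefl.
have fb : f b = F None.
  apply: val_inj; case: fP => _ _ /(_ i w) /=.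
  rewrite /w two_dipole_mateK' -/w fw => <-; rewrite F0 val_two_dipole_mate.
  by rewrite eq_sym (negPf nid) eqxx ot.
have {}fw : f w = h None by apply: val_inj; rewrite fw /= h0.
pose A := @ins D (two_dipole d i l) (mel d (Ordinal lt1)).
pose B := @ins D A (cre i (mel d (Ordinal lt0))).
have I1 := @annihilate_iso D (two_dipole i0 i1 l.+1) (two_dipole d i l.+1) f f b w fP.
have I2 := @annihilate_iso D B (two_dipole d i l.+1) F h None None Fh.
have I3 := @annihilate_ins D A (cre i (mel d (Ordinal lt0))).
rewrite fb fw in I1.
have SA : S_set A.
  by apply: (@S_set_mel (two_dipole d i l)); apply: S_set_two_dipole => //; lia.
exact: S_set_iso SA (iso_trans (iso_sym I3) (iso_trans I2 (iso_sym I1))).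
Qed.

Lemma S_set_annihilate G : S_set G -> forall i (b : black G) XB XW,
  annihilation_cut i b XB XW -> S_set (annihilate b (mate i b)).
Proof.
move: G; apply: S_set_ind => [G H IH [f [h fh]]|i0 i1 l ne l0|H m e SH IH] i b XB XW [bX wX cutX].
- have [f' [h' [fK f'K hK h'K fh']]] := iso_by_inv fh.
  have : S_set (annihilate (f' b) (mate i (f' b))).
    case: fh => _ _ e; apply: (IH i _ (XB \o f) (XW \o h)); split=> /= [||j x ji].
    - by rewrite f'K.
    - by rewrite -e f'K.
    - by rewrite -e; exact: cutX.
  move/S_set_iso; apply; have := annihilate_iso (f' b) (mate i (f' b)) fh.
  by case: fh => _ _ <-; rewrite f'K.
- exact: S_set_two_dipole_annihilate ne (And3 bX wX cutX).
have [r [ri rm _]] := other_color i m m.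
have XN : XW None = XB None.
  by have := cutX r None ri; rewrite /= /mel (negPf rm).
case: b bX wX => [x|] bX.
  case E : (mate i (Some x : black (ins (mel m e)))) => [w|] wX.
  - have [ew nmx] : w = mate i x /\ (i == m) && (e == x) = false.
      move: E; rewrite /= /mel; case: (i == m) => /= [|[]//].
      by rewrite (inj_eq Some_inj); case: (e == x) => // -[].
    have cutH : annihilation_cut i x (XB \o Some) (XW \o Some).
      split=> //=; first by rewrite -ew.
      move=> j y ji; have := cutX j (Some y) ji; have := cutX j None ji.
      rewrite /= /mel; case: (j == m) => //=.
      by rewrite (inj_eq Some_inj); case: (e =P y) => [->|_ _] // -> <-.
    have SK := IH _ _ _ _ cutH; rewrite -ew in SK.
    pose s := @reinsert D H x w.
    have [f [h [uf fu hu _ fh]]] := iso_by_inv (ins_annihilate x w).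
    have fx : f x = None by rewrite -(uf None).
    have hw : h w = None by rewrite -(hu None).
    pose K := annihilate x w.
    (* After the interchange the melon must still be one. This could fail only on an edge from [x]
       to [w] of color other than [i], which the cut excludes. *)
    have [e2 he2] : exists e2, mel m e2 =1 swap_in (@mel D _ m (f e)) s.
      case fe : (f e) => [y|].
        by exists y => j; rewrite /swap_in /mel; case: (j == m).
      have {fe} xe : x = e by rewrite -(fu e) fe.
      case sm : (s m) => [y|].
        exists y => j; rewrite /swap_in /mel.
        by case: (j =P m) => // ->.
      have mx : mate m x = w.
        by case: (ins_annihilate x w) => _ _ /(_ m None) /=; rewrite -/s sm.
      have mi : m != i by rewrite eq_sym -[_ == _]andbT -(eqxx e) -{2}xe nmx.
      have [bK _ cutK] := cutH.
      by move: bK; rewrite -(cutK m x mi) mx /= wX.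
    pose A := @ins D K (mel m e2).
    pose B := @ins D K s.
    have iso1 : @iso_by D (ins (mel m e)) (@ins D B (mel m (f e))) (omap f) (omap h).
      by apply: ins_iso fh _ => j; rewrite /mel; case: (j == m).
    pose t := swap_out (@mel D _ m (f e)) s.
    have iso2 := ins_swap he2 (frefl t).
    pose B' := @ins D B (mel m (f e)).
    have I1 := @annihilate_iso D (ins (mel m e)) B' _ _ (Some x) (Some w) iso1.
    rewrite /= fx hw in I1.
    have I2 := @annihilate_iso D B' (@ins D A t) _ _ (Some None) (Some None) iso2.
    have I3 := @annihilate_ins D A t.
    have SA : S_set A by apply: (@S_set_mel K).
    exact: S_set_iso SA (iso_trans (iso_sym I3) (iso_sym (iso_trans I1 I2))).
  (* The dipole consists of [e] and the white melon vertex; its annihilation gives back [H]. *)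
  - have -> : x = e.
      move: E; rewrite /= /mel; case: (i == m) => //=.
      by rewrite (inj_eq Some_inj); case: eqP.
    have I1 := @annihilate_iso D (@ins D H (cre m (fun=> e))) (ins (mel m e)) _ _ None None
      (ins_cre_black m e).
    exact: S_set_iso SH (iso_trans (iso_sym (annihilate_ins _)) I1).
case E : (mate i (None : black (ins (mel m e)))) => [w|] wX; last first.
  by move: wX; rewrite XN (negPf bX).
have ew : w = mate m e.
  by move: E; rewrite /= /mel; case: (i =P m) => //= -> [].
(* Seen from [w], the melon is a creation cutting all edges at [w] but that of color [m]; [xchoose]
   names their black ends. *)
have ex j : exists y, mate j y == w.
  by have [m' _ m'K] := mate_bij H j; exists (m' w); rewrite m'K.
have cw j : mate j (xchoose (ex j)) = w by apply/eqP/(xchooseP (ex j)).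
have cm : xchoose (ex m) = e by apply: (@mate_inj _ H m); rewrite cw.
have := @annihilate_iso D (ins (cre m _)) (ins (mel m _)) _ _ None None
  (ins_cre_white m cw).
rewrite cm /= => I1; exact: S_set_iso SH (iso_trans (iso_sym (annihilate_ins _)) I1).
Qed.

End Closure.

Theorem proposition3p3 (D : nat) (hD : 3 <= D) :
  (forall (i : 'I_D.+1) (G G' : cgraph D),
     S_set G -> creation1 i G G' -> S_set G') /\
  (forall (i : 'I_D.+1) (G G' : cgraph D),
     S_set G -> annihilation1 i G G' -> S_set G').
Proof.
split=> i G G' SG.
- case=> c [/create_cut [XB [XW cutX]] GG'].
  apply: S_set_iso (S_set_create hD SG cutX) _.
  exact: iso_trans (iso_sym (iso_create i c)) GG'.
- case=> b [w [dip GG']]; have [XB [XW [bX wX cutX]]] := dipole_cut dip.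
  case: dip GG' => [bw _] GG'; rewrite -bw in wX GG'.
  exact: S_set_iso (S_set_annihilate hD SG (And3 bX wX cutX)) GG'.
Qed.
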